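(* Let $\mathcal N$ be a completion ring for $\mu$ and $\nu = \mathfrak C_{\mathcal N}\mu$. (i) $\mathcal N'$ is a completion ring for $\nu$ if and only if $\mathcal N'$ is a completion ring for $\mu$ and $\mathcal N\subset \mathcal N'$. (ii) Let $\mathcal N'$ be a completion ring for $\nu$. Then $\mathfrak C_{\mathcal N'}\nu = \mathfrak C_{\mathcal N'}\mu$.
   Context: $D_\mu$ denotes the domain of a map $\mu$; all maps here have as domain a set of sets, and their values are arbitrary. Two maps are equal if they have the same domain and the same values. A ring (of sets) is a nonempty set of sets closed under union $A\cup B$ and difference $A\setminus B$. $A\Delta B=(A\setminus B)\cup(B\setminus A)$. For a map $\mu$ with $\varnothing\in D_\mu$, a set $N\in D_\mu$ is $\mu$-null if $\mu(N')=\mu(\varnothing)$ for every $N'\in D_\mu$ with $N'\subset N$; $\mathcal N_\mu$ is the set of all $\mu$-null sets. The map $\mu$ admits completion if $D_\mu$ is a ring and $\mu(B_1)=\mu(B_2)$ for all $B_1,B_2\in D_\mu$ with $B_1\Delta B_2\in\mathcal N_\mu$. If $\mu$ admits completion, a completion ring for $\mu$ is a ring $\mathcal N$ such that $N\cap B\in\mathcal N$ for all $N\in\mathcal N$, $B\in D_\mu$, and $\mathcal N\cap D_\mu=\mathcal N_\mu$ (saying that $\mathcal N$ is a completion ring for $\mu$ includes that $\mu$ admits completion). For sets of sets $\mathcal Q,\mathcal N$, $\Delta(\mathcal Q,\mathcal N)=\{A: A\Delta B\in\mathcal N\text{ for some }B\in\mathcal Q\}$. The $\mathcal N$-completion $\mathfrak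 C_{\mathcal N}\mu$ is the unique (well-defined) map $\nu$ with $D_\nu=\Delta(D_\mu,\mathcal N)$ and $\nu(A)=\mu(B)$ whenever $A\in D_\nu$, $B\in D_\mu$, $A\Delta B\in\mathcal N$. It is known that $\mathfrak C_{\mathcal N}\mu$ again admits completion. *)

(* Defs.v *)
From mathcomp Require Import all_boot.
From mathcomp Require Import boolp classical_sets measurable_structure.

Set Implicit Arguments.
Unset Strict Implicit.
Unset Printing Implicit Defensive.

Local Open Scope classical_set_scope.

(* All sets are subsets of an ambient type T, which is arbitrary: T plays the
   role of any set containing all the members of the domains and rings under
   consideration.  None of the notions below depends on its choice. *)

(* A map with values in V whose domain is a set of subsets of T, coded as a
   partial function: mu A = None means that A lies outside the domain.  Leibniz
   equality of such maps is equality of the domains and of the values. *)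
Definition setmap (T V : Type) : Type := set T -> option V.

Definition dom (T V : Type) (mu : setmap T V) : set (set T) :=
  [set A | isSome (mu A)].

Lemma setmap_eqP (T V : Type) (mu nu : setmap T V) :
  mu = nu <-> dom mu = dom nu /\ (forall A, dom mu A -> mu A = nu A).
Proof.
split=> [->//|[domE valE]]; apply/funext => A.
have [/valE//|muA] := pselect (dom mu A).
have nuA : ~ dom nu A by rewrite -domE.
by move: muA nuA; rewrite /dom/=; case: (mu A); case: (nu A).
Qed.

(* The library's setring asks for the empty set to be a member instead of
   nonemptiness. *)
Lemma setringP (T : Type) (G : set (set T)) :
  setring G <-> [/\ G !=set0, setU_closed G & setD_closed G].
Proof.
split=> [[G0 GU GD]|[[A GA] GU GD]]; split=> //; first by exists set0.
by rewrite -(setDv A); exact: GD.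
Qed.

(* Meaningful when set0 is in the domain of mu. *)
Definition null_sets (T V : Type) (mu : setmap T V) : set (set T) :=
  [set N | dom mu N /\
           forall N', dom mu N' -> N' `<=` N -> mu N' = mu set0].

Definition admits_completion (T V : Type) (mu : setmap T V) : Prop :=
  setring (dom mu) /\
  forall B1 B2, dom mu B1 -> dom mu B2 -> null_sets mu (B1 `+` B2) ->
    mu B1 = mu B2.

Definition completion_ring (T V : Type) (mu : setmap T V) (N : set (set T)) :
    Prop :=
  [/\ admits_completion mu,
      setring N,
      forall M B, N M -> dom mu B -> N (M `&` B) &
      N `&` dom mu = null_sets mu].

Definition Delta (T : Type) (Q N : set (set T)) : set (set T) :=
  [set A | exists2 B, Q B & N (A `+` B)].

Definition is_completion (T V : Type) (N : set (set T)) (mu nu : setmap T V) :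
    Prop :=
  dom nu = Delta (dom mu) N /\
  forall A B, dom nu A -> dom mu B -> N (A `+` B) -> nu A = mu B.

(* The value at A is read off from a chosen B; completionP below shows that the
   choice is immaterial when N is a completion ring for mu. *)
Definition completion (T V : Type) (N : set (set T)) (mu : setmap T V) :
    setmap T V :=
  fun A => if pselect (Delta (dom mu) N A) is left AN
           then mu (s2val (cid2 AN)) else None.

Lemma completionP (T V : Type) (N : set (set T)) (mu nu : setmap T V) :
  completion_ring mu N -> is_completion N mu nu <-> nu = completion N mu.
Proof.
move=> [[[_ domU domD] mu_eq] [_ NU ND] _ NE].
have complN : is_completion N mu (completion N mu).
  split=> [|A B].
    apply/seteqP; split=> A; rewrite /dom /completion/=; case: pselect => //.
    by move=> AN _; case: cid2.
  rewrite /dom /completion/=; case: pselect => // AN _ domB NAB.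
  case: cid2 => C domC NAC /=; apply: mu_eq => //; rewrite -NE; split.
    have -> : C `+` B = (A `+` C) `+` (A `+` B).
      by rewrite [A `+` C]setYC -setYA [A `+` (_ `+` _)]setYA setYK set0Y.
    by apply: NU; exact: ND.
  by apply: domU; exact: domD.
split=> [[domE valE]|->//]; apply/setmap_eqP; split=> [|A domA].
  by rewrite domE complN.1.
have := domA; rewrite domE => -[B domB NAB].
by rewrite (valE A B)// (complN.2 A B)// complN.1 -domE.
Qed.

(* Main.v *)
Require Import Defs.
From mathcomp Require Import all_boot.
From mathcomp Require Import boolp classical_sets measurable_structure.

Set Implicit Arguments.
Unset Strict Implicit.

Local Open Scope classical_set_scope.

(** Write [D] for the domain of [mu], [nu] for the [N]-completion of [mu] and
[E] for the domain of [nu].  Subsets of [T] form a Boolean ring, with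
symmetric difference as addition and intersection as multiplication.  There,
rings of sets are the subrings (without unit), the condition that [N] absorbs
intersections with [D] makes [N] an ideal of [D + N], and
[E = Delta D N] is just [D + N] ([DeltaP]).  Hence [E] is a ring
([setring_Delta]) of which [N] is an ideal, and [nu] is the function that [mu]
induces on the cosets of [N].

The key fact is that the null sets of [nu] are exactly the members of [N]
([null_sets_completion]).  A member of [N] is [nu]-null because its subsets in
[E] are again in [N], by the ideal property.  Conversely, if [B + M] is
[nu]-null with [B] in [D] and [M] in [N], then every [B'] in [D] below [B]
differs by a member of [N] from [B' `\` M], which lies below [B + M]; so
[mu B' = mu set0], and [B] is [mu]-null, hence in [N].

For the equivalence, a completion ring [N'] for [nu] must therefore satisfy
[N' `&` E = N].  This gives [N `<=` N'], and intersecting with [D] gives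
[N' `&` D = N `&` D], the [mu]-null sets.  In the other direction, if [N'] is a
completion ring for [mu] containing [N], then [N'] absorbs [E = D + N], and an
[A] in [N' `&` E], say [A = B + M], has [B = A + M] in [N' `&` D], hence in [N], so
that [A] itself is in [N].  Finally, since [N + N' = N'], both completions
along [N'] have domain [D + N'], and both take the value [mu B] on the coset
[B + N']. *)

(** * Rings of sets as Boolean rings *)

Lemma setYKr (T : Type) (A B : set T) : A `+` B `+` B = A.
Proof. by rewrite -setYA setYK setY0. Qed.

Lemma setring_setY (T : Type) (G : set (set T)) A B :
  setring G -> G A -> G B -> G (A `+` B).
Proof. by move=> [_ GU GD] GA GB; apply: GU; apply: GD. Qed.

Lemma setring_setI (T : Type) (G : set (set T)) A B :
  setring G -> G A -> G B -> G (A `&` B).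
Proof. by move=> [_ GU GD] GA GB; rewrite -setDD; apply: (GD) => //; exact: GD. Qed.

Lemma setring_of_setYI (T : Type) (G : set (set T)) :
  G set0 -> (forall A B, G A -> G B -> G (A `+` B)) ->
  (forall A B, G A -> G B -> G (A `&` B)) -> setring G.
Proof.
move=> G0 GY GI; split=> // A B GA GB.
  by rewrite -setYU; apply: (GY); [exact: GY|exact: GI].
by rewrite -setYD; apply: GY => //; exact: GI.
Qed.

(** [Delta Q N] is the sum [Q + N] in the Boolean ring of sets, because
[A `+` B = M] can be solved for [A] as [A = B `+` M]. *)
Lemma DeltaP (T : Type) (Q N : set (set T)) A :
  Delta Q N A <-> exists B M, [/\ Q B, N M & A = B `+` M].
Proof.
split=> [[B QB NAB]|[B [M [QB NM ->]]]]; last first.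
  by exists B => //; rewrite setYC setYA setYK set0Y.
by exists B, (A `+` B); split=> //; rewrite [A `+` B]setYC setYA setYK set0Y.
Qed.

Lemma sub_Delta_l (T : Type) (Q N : set (set T)) : N set0 -> Q `<=` Delta Q N.
Proof. by move=> N0 B QB; exists B => //; rewrite setYK. Qed.

Lemma sub_Delta_r (T : Type) (Q N : set (set T)) : Q set0 -> N `<=` Delta Q N.
Proof. by move=> Q0 M NM; exists set0 => //; rewrite setY0. Qed.

(** Absorbing [Q] and being closed under intersection, [N'] absorbs the sum of
[Q] and [N] by distributivity. *)
Lemma Delta_absorb (T : Type) (Q N N' : set (set T)) :
  setring N' -> N `<=` N' -> (forall M B, N' M -> Q B -> N' (M `&` B)) ->
  forall M A, N' M -> Delta Q N A -> N' (M `&` A).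
Proof.
move=> rN' NN' N'Q M A N'M /DeltaP[B [M1 [QB NM1 ->]]].
rewrite setIYr; apply: setring_setY => //; first exact: N'Q.
by apply: setring_setI => //; exact: NN'.
Qed.

(** The sum of a subring [Q] and an ideal [N] is a subring: in the product of
[B1 + M1] and [B2 + M2], every term but [B1 `&` B2] is in the ideal. *)
Lemma setring_Delta (T : Type) (Q N : set (set T)) :
  setring Q -> setring N -> (forall M B, N M -> Q B -> N (M `&` B)) ->
  setring (Delta Q N).
Proof.
move=> rQ rN NQ; have [Q0 _ _] := rQ; have [N0 _ _] := rN.
apply: setring_of_setYI => [|A1 A2|A1 A2]; first exact: sub_Delta_l.
  move=> /DeltaP[B1 [M1 [QB1 NM1 ->]]] /DeltaP[B2 [M2 [QB2 NM2 ->]]].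
  apply/DeltaP; exists (B1 `+` B2), (M1 `+` M2); split.
  - exact: setring_setY.
  - exact: setring_setY.
  - by rewrite -!setYA; congr (_ `+` _); rewrite setYA [M1 `+` B2]setYC -setYA.
move=> /DeltaP[B1 [M1 [QB1 NM1 ->]]] EA2.
have /DeltaP[B2 [M2 [QB2 NM2 A2E]]] := EA2.
apply/DeltaP; exists (B1 `&` B2), ((M2 `&` B1) `+` (M1 `&` A2)); split.
- exact: setring_setI.
- by apply: setring_setY => //; [exact: NQ|exact: (@Delta_absorb _ Q N)].
- by rewrite setIYl {1}A2E setIYr [B1 `&` M2]setIC setYA.
Qed.

(** * The completion and its null sets *)

Lemma dom_completion (T V : Type) (mu : setmap T V) (N : set (set T)) :
  completion_ring mu N -> dom (completion N mu) = Delta (dom mu) N.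
Proof. by move=> hN; have [] := (completionP (completion N mu) hN).2 erefl. Qed.

Lemma completionE (T V : Type) (mu : setmap T V) (N : set (set T)) A B :
  completion_ring mu N -> dom mu B -> N (A `+` B) -> completion N mu A = mu B.
Proof.
move=> hN DB NAB; have [domE valE] := (completionP (completion N mu) hN).2 erefl.
by apply: valE => //; rewrite domE; exists B.
Qed.

Lemma completion_extends (T V : Type) (mu : setmap T V) (N : set (set T)) B :
  completion_ring mu N -> dom mu B -> completion N mu B = mu B.
Proof.
by move=> hN DB; apply: completionE => //; rewrite setYK; have [_ []] := hN.
Qed.

Lemma setring_dom_completion (T V : Type) (mu : setmap T V) (N : set (set T)) :
  completion_ring mu N -> setring (dom (completion N mu)).
Proof.
move=> hN; rewrite dom_completion//.
by have [[rD _] rN ND _] := hN; exact: setring_Delta.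
Qed.

(** Completing adds no null sets beyond those of [N]: a null set of the
completion is [B + M] with [M] in [N], and [B] inherits nullity for [mu] because
the sets [B' `\` M], with [B'] below [B], lie below [B + M]. *)
Lemma null_sets_completion (T V : Type) (mu : setmap T V) (N : set (set T)) :
  completion_ring mu N -> null_sets (completion N mu) = N.
Proof.
move=> hN; have rE := setring_dom_completion hN; have domE := dom_completion hN.
have [[[D0 _ _] _] rN ND nullE] := hN; have [N0 _ _] := rN.
have nu0 : completion N mu set0 = mu set0 by exact: completion_extends.
apply/seteqP; split=> [A [EA nullA]|M NM].
  have := EA; rewrite domE => /DeltaP[B [M [DB NM AE]]].
  suff : null_sets mu B.
    by rewrite -nullE => -[NB _]; rewrite AE; exact: setring_setY.
  split=> // B' DB' B'B.
  have EM : dom (completion N mu) M by rewrite domE; exact: sub_Delta_r.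
  have EB' : dom (completion N mu) B' by rewrite domE; exact: sub_Delta_l.
  rewrite -nu0 -(nullA (B' `\` M)).
  - apply/esym; apply: completionE => //.
    by rewrite -setYD setYC setYA setYK set0Y setIC; exact: ND.
  - by have [_ _] := rE; exact.
  - by move=> x [B'x nMx]; rewrite AE; left; split=> //; exact: B'B.
split=> [|A EA AM]; first by rewrite domE; exact: sub_Delta_r.
rewrite nu0; apply: completionE => //.
(* A set below [M] is its own intersection with [M], which the ideal absorbs. *)
rewrite setY0 -(setIidr AM); apply: (@Delta_absorb _ (dom mu) N) => //.
by rewrite -domE.
Qed.

(** Two members of the domain that differ by a null set, that is by a member of
[N], lie in one coset of [N]. *)
Lemma admits_completion_completion (T V : Type) (mu : setmap T V)
    (N : set (set T)) :
  completion_ring mu N -> admits_completion (completion N mu).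
Proof.
move=> hN; split=> [|A1 A2 E1 _]; first exact: setring_dom_completion.
rewrite null_sets_completion// => N12.
move: E1; rewrite dom_completion// => -[B DB N1B].
rewrite (completionE hN DB N1B); apply/esym; apply: completionE => //.
have -> : A2 `+` B = (A1 `+` A2) `+` (A1 `+` B).
  by rewrite [A1 `+` A2]setYC setYA setYKr.
by have [_ rN _ _] := hN; exact: setring_setY.
Qed.

(** * Completion rings of a completion *)

Lemma completion_ring_completion (T V : Type) (mu : setmap T V)
    (N N' : set (set T)) :
  completion_ring mu N ->
  completion_ring (completion N mu) N' <-> completion_ring mu N' /\ N `<=` N'.
Proof.
move=> hN; have domE := dom_completion hN.
have [adm rN ND nullE] := hN; have [[D0 _ _] _] := adm; have [N0 _ _] := rN.
have DE : dom mu `<=` dom (completion N mu) by rewrite domE; exact: sub_Delta_l.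
split.
  move=> [_ rN' N'E null'E]; move: null'E; rewrite null_sets_completion// => NE.
  split; last by rewrite -NE => M [].
  split=> // [M B N'M /DE|]; first exact: N'E.
  by rewrite -nullE -NE -setIA (setIidr DE).
move=> [[_ rN' N'D null'E] NN']; split=> //.
- exact: admits_completion_completion.
- by rewrite domE; exact: Delta_absorb.
rewrite null_sets_completion//; apply/seteqP; split=> [A [N'A]|M NM]; last first.
  by split; [exact: NN'|rewrite domE; exact: sub_Delta_r].
rewrite domE => /DeltaP[B [M [DB NM AE]]].
suff : (N' `&` dom mu) B.
  by rewrite null'E -nullE => -[NB _]; rewrite AE; exact: setring_setY.
split=> //; have -> : B = A `+` M by rewrite AE setYKr.
by apply: setring_setY => //; exact: NN'.
Qed.

(** The sum of [D + N] and [N'] is [D + N'] since [N'] swallows [N]; on the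
domain of [mu] the two maps to be completed agree. *)
Lemma completion_completion (T V : Type) (mu : setmap T V)
    (N N' : set (set T)) :
  completion_ring mu N -> completion_ring (completion N mu) N' ->
  completion N' (completion N mu) = completion N' mu.
Proof.
move=> hN hN'; have [hmu NN'] := (completion_ring_completion _ hN).1 hN'.
have domE := dom_completion hN.
have [_ [N0 _ _] _ _] := hN; have [_ rN' _ _] := hN'.
have DE : dom mu `<=` dom (completion N mu) by rewrite domE; exact: sub_Delta_l.
apply/(completionP _ hmu); split=> [|A B _ DB N'AB]; last first.
  by rewrite (completionE hN' (DE _ DB) N'AB) completion_extends.
rewrite dom_completion//; apply/seteqP; split=> A; last first.
  by move=> [B DB N'AB]; exists B => //; exact: DE.
move=> [A1]; rewrite domE => -[B DB NA1B] N'AA1; exists B => //.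
have -> : A `+` B = (A `+` A1) `+` (A1 `+` B) by rewrite setYA setYKr.
by apply: setring_setY => //; exact: NN'.
Qed.

Theorem proposition3p10 (T V : Type) (mu : setmap T V) (N : set (set T))
    (hN : completion_ring mu N) :
  (forall N' : set (set T),
     completion_ring (completion N mu) N' <->
     completion_ring mu N' /\ N `<=` N') /\
  (forall N' : set (set T),
     completion_ring (completion N mu) N' ->
     completion N' (completion N mu) = completion N' mu).
Proof.
split=> N'; first exact: completion_ring_completion.
exact: completion_completion.
Qed.
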